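(* Let $(\Omega,\mathcal{F},\mathbb{P})$ be a probability space with a discrete-time filtration $(\mathcal{F}_n)_{n\ge0}$, and let $X=(X_n)_{n\ge0}$ be a discrete time near-submartingale. Suppose $\sigma$ and $\tau$ are two bounded stopping times with $\sigma\le\tau$. Then $X_\sigma$ and $X_\tau$ are integrable, and $\mathbb{E}(X_\tau-X_\sigma\mid\mathcal{F}_\sigma)\ge0$ almost surely.
   Context: A discrete time near-submartingale with respect to $(\mathcal{F}_n)_{n\ge0}$ is a process $(X_n)_{n\ge0}$ of integrable random variables such that for all $m\le n$, $\mathbb{E}(X_n-X_m\mid\mathcal{F}_m)\ge0$ almost surely (adaptedness of $X$ is not part of the definition). $\mathcal{F}_\sigma$ denotes the usual $\sigma$-field of events prior to the stopping time $\sigma$. *)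

(* Defs.v *)
From HB Require Import structures.
From mathcomp Require Import all_boot all_order all_algebra.
From mathcomp Require Import all_classical all_reals all_analysis.
From mathcomp Require Import measurable_realfun.

Set Implicit Arguments.
Unset Strict Implicit.
Unset Printing Implicit Defensive.

Import Order.TTheory GRing.Theory Num.Theory.
Import numFieldNormedType.Exports.

Local Open Scope classical_set_scope.
Local Open Scope ring_scope.

Definition sub_sigma_algebra_of d (T : measurableType d) (G : set (set T)) :=
  sigma_algebra setT G /\ G `<=` measurable.

(* [Z] is a version of the conditional expectation of [Y] given [G]. When [G]
   is a sigma-algebra, the measurable sets of [g_sigma_algebraType G] are
   exactly the elements of [G], so that measurability below is
   [G]-measurability. *)
Definition is_cond_exp d (T : measurableType d) (R : realType)
    (P : probability T R) (G : set (set T)) (Y Z : T -> R) : Prop :=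
  [/\ @measurable_fun _ _ (g_sigma_algebraType G) R setT Z,
      P.-integrable setT (EFin \o Z) &
      forall A, G A ->
        (\int[P]_(w in A) (Z w)%:E = \int[P]_(w in A) (Y w)%:E)%E].

(* A chosen version of E(Y | G); meaningful for [Y] integrable and [G] a
   sub-sigma-algebra, in which case a version exists (cond_expP) and is unique
   up to a negligible set (is_cond_exp_unique). *)
Definition cond_exp d (T : measurableType d) (R : realType)
    (P : probability T R) (G : set (set T)) (Y : T -> R) : T -> R :=
  xget (fun=> 0) [set Z | is_cond_exp P G Y Z].

(* Existence and uniqueness of densities along a measurable map [phi]; used
   below with [phi] the identity from [T] to [g_sigma_algebraType G], so that
   no two sigma-algebras live on syntactically the same type. *)
Section factor_through.
Context d d' (T : measurableType d) (T' : measurableType d') (R : realType).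
Variables (P : probability T R) (phi : {mfun T >-> T'}).

Let PG : probability T' R := distribution P phi.

Let mpre A : measurable A -> measurable (phi @^-1` A).
Proof. exact: measurable_funPTI. Qed.

Lemma factor_density_ex (Y : T -> R) : P.-integrable setT (EFin \o Y) ->
  exists f : T' -> R, [/\ measurable_fun setT f,
    P.-integrable setT (EFin \o (f \o phi)) &
    forall A, measurable A ->
      (\int[P]_(w in phi @^-1` A) (f (phi w))%:E =
       \int[P]_(w in phi @^-1` A) (Y w)%:E)%E].
Proof.
move=> iY.
have mphi : measurable_fun setT phi by exact: measurable_funP.
pose nuG : {charge set T' -> \bar R} :=
  measure_function_pushforward__canonical__charge_Charge
    (induced_charge iY) mphi.
have dom : nuG `<< PG.
  apply/null_content_dominatesP => A mA PA0.
  apply: null_set_integral => //; first exact: mpre.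
  have /integrableP[mY _] := iY.
  exact: measurable_funTS.
pose f := Radon_Nikodym nuG PG.
have ffin x : f x \is a fin_num by exact: Radon_Nikodym_fin_num.
have fint : PG.-integrable setT f := Radon_Nikodym_integrable dom.
have /integrableP[mf foo] := fint.
have ifT : P.-integrable setT (f \o phi).
  apply/integrableP; split; first exact: measurableT_comp.
  apply: le_lt_trans foo.
  rewrite (ge0_integral_distribution (phi : {RV P >-> T'}) (f := abse \o f)) //=.
  exact: measurableT_comp.
exists (fine \o f); split.
- exact: measurableT_comp.
- by apply: eq_integrable ifT => // w _ /=; rewrite fineK.
- move=> A mA.
  transitivity (\int[P]_(w in phi @^-1` A) (f \o phi) w)%E.
    by apply: eq_integral => w _; rewrite /= fineK.
  rewrite -(integral_pushforward mphi mf)//.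
    by rewrite -(Radon_Nikodym_integral dom mA).
  by apply: integrableS ifT => //; exact: mpre.
Qed.

Lemma factor_density_unique (f1 f2 : T' -> R) :
  measurable_fun setT f1 -> measurable_fun setT f2 ->
  P.-integrable setT (EFin \o (f1 \o phi)) ->
  P.-integrable setT (EFin \o (f2 \o phi)) ->
  (forall A, measurable A ->
    (\int[P]_(w in phi @^-1` A) (f1 (phi w))%:E =
     \int[P]_(w in phi @^-1` A) (f2 (phi w))%:E)%E) ->
  {ae P, forall w, f1 (phi w) = f2 (phi w)}.
Proof.
move=> mf1 mf2 if1 if2 f12.
have mphi : measurable_fun setT phi by exact: measurable_funP.
have mE1 : measurable_fun setT (EFin \o f1) by exact/measurable_EFinP.
have mE2 : measurable_fun setT (EFin \o f2) by exact/measurable_EFinP.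
have iE1 : PG.-integrable setT (EFin \o f1).
  exact: (integrable_pushforward mphi).
have [|A [mA PA0 ZA]] :=
    @integral_ae_eq _ _ _ PG _ measurableT (EFin \o f2) (EFin \o f1) iE1 mE2.
  move=> A _ mA; rewrite !(integral_pushforward mphi)//.
  - exact: f12.
  - by apply: integrableS if2 => //; exact: mpre.
  - by apply: integrableS if1 => //; exact: mpre.
exists (phi @^-1` A); split => //; first exact: mpre.
move=> w /= Zw; apply: ZA => /= h; apply: Zw.
by apply: EFin_inj; exact: h.
Qed.

End factor_through.

Section cond_exp_theory.
Context d (T : measurableType d) (R : realType) (P : probability T R).
Variable G : set (set T).
Hypothesis hG : sub_sigma_algebra_of G.

Let to_sub : T -> g_sigma_algebraType G := id.

Let measurable_subE : G.-sigma.-measurable = G.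
Proof. by apply: measurable_g_measurableTypeE; case: hG. Qed.

Let measurable_to_sub : measurable_fun setT to_sub.
Proof. by move=> _ A; rewrite setTI measurable_subE; case: hG => _; apply. Qed.

HB.instance Definition _ := isMeasurableFun.Build _ _ _ _ to_sub
  measurable_to_sub.

Lemma is_cond_exp_ex (Y : T -> R) : P.-integrable setT (EFin \o Y) ->
  exists Z, is_cond_exp P G Y Z.
Proof.
move=> /(factor_density_ex to_sub)[f [mf fint fE]].
by exists f; split => // A GA; apply: fE; rewrite measurable_subE.
Qed.

Lemma cond_expP (Y : T -> R) : P.-integrable setT (EFin \o Y) ->
  is_cond_exp P G Y (cond_exp P G Y).
Proof.
by move=> /is_cond_exp_ex[Z hZ]; rewrite /cond_exp; case: xgetP => [//|/(_ Z)].
Qed.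

Lemma is_cond_exp_unique (Y Z1 Z2 : T -> R) :
  is_cond_exp P G Y Z1 -> is_cond_exp P G Y Z2 -> {ae P, forall w, Z1 w = Z2 w}.
Proof.
move=> [mZ1 iZ1 Z1E] [mZ2 iZ2 Z2E].
apply: (@factor_density_unique _ _ _ _ _ P to_sub Z1 Z2) => //.
by move=> A; rewrite measurable_subE => GA; rewrite [LHS]Z1E// [RHS]Z2E.
Qed.

End cond_exp_theory.

Record filtration d (T : measurableType d) (F : nat -> set (set T)) : Prop := {
  filtration_sub : forall n, sub_sigma_algebra_of (F n) ;
  filtration_le : forall m n, (m <= n)%N -> F m `<=` F n }.

(* Stopping times are allowed to take only finite values, which is no
   restriction for bounded ones. *)
Definition stopping_time T (F : nat -> set (set T)) (sigma : T -> nat) :=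
  forall n, F n [set w | (sigma w <= n)%N].

Definition bounded_time T (sigma : T -> nat) :=
  exists N, forall w, (sigma w <= N)%N.

Definition stopped_sigma_algebra d (T : measurableType d)
    (F : nat -> set (set T)) (sigma : T -> nat) : set (set T) :=
  [set A | measurable A /\ forall n, F n (A `&` [set w | (sigma w <= n)%N])].

Definition stopped_value T (R : Type) (X : nat -> T -> R) (sigma : T -> nat) :
  T -> R := fun w => X (sigma w) w.

(* Integrability includes measurability with respect to the ambient
   sigma-algebra; [X n] need not be [F n]-measurable. *)
Record near_submartingale d (T : measurableType d) (R : realType)
    (P : probability T R) (F : nat -> set (set T)) (X : nat -> T -> R) : Prop :=
  { near_submartingale_integrable : forall n, P.-integrable setT (EFin \o X n) ;
    near_submartingale_cond_exp_ge0 : forall m n, (m <= n)%N ->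
      {ae P, forall w, 0 <= cond_exp P (F m) (X n \- X m) w} }.

Lemma stopped_sigma_algebra_sub d (T : measurableType d)
    (F : nat -> set (set T)) (sigma : T -> nat) :
  filtration F -> stopping_time F sigma ->
  sub_sigma_algebra_of (stopped_sigma_algebra F sigma).
Proof.
move=> [Fsub _] st; split; last by move=> A [].
split.
- split=> // n; rewrite set0I.
  by have [[]] := Fsub n.
- move=> A [mA FA]; rewrite setTD; split; first exact: measurableC.
  move=> n; have [Fn _] := Fsub n.
  rewrite [X in F n X](_ : _ = [set w | (sigma w <= n)%N] `\`
      (A `&` [set w | (sigma w <= n)%N])); last first.
    by rewrite setDIr setDv setU0 setIC.
  rewrite -(measurable_g_measurableTypeE Fn); apply: measurableD.
    by rewrite measurable_g_measurableTypeE//; exact: st.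
  by rewrite measurable_g_measurableTypeE//; exact: FA.
- move=> A FA; split; first by apply: bigcup_measurable => n _; case: (FA n).
  move=> n; rewrite setI_bigcupl; have [[_ _ Fn] _] := Fsub n.
  by apply: Fn => i; case: (FA i).
Qed.

(* Main.v *)
Require Import Defs.
From mathcomp Require Import all_boot all_order all_algebra.
From mathcomp Require Import all_classical all_reals all_analysis.
From mathcomp Require Import measurable_realfun.

Import Order.TTheory GRing.Theory Num.Theory.
Import numFieldNormedType.Exports.

Local Open Scope classical_set_scope.
Local Open Scope ring_scope.

(** Optional sampling reduces to one step at a time: on a path bounded by [N],
[X_tau - X_sigma] is the sum over [k < N] of the increments [X_(k+1) - X_k]
for which [sigma <= k < tau].  Two things follow.

With [sigma = 0] this writes [X_tau - X_0] as a finite sum of integrable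
increments restricted to events, so [X_tau] is integrable.

For [A] in [F_sigma] the event [A `&` {sigma <= k < tau}] belongs to [F_k]:
the part [A `&` {sigma <= k}] does by the definition of [F_sigma], and
[{k < tau}] is the complement of [{tau <= k}].  The near-submartingale property
at times [k <= k+1] therefore makes each integral of [X_(k+1) - X_k] over such
an event nonnegative, hence also their sum, the integral of [X_tau - X_sigma]
over [A] ([integral_stopped_increment_ge0]).

The passage between conditional expectations and integrals is the equivalence:
[E(Y | G) >= 0] almost surely iff [Y] has a nonnegative integral over every
element of [G] ([cond_exp_ge0P]).  It is used for [G = F_k] in one direction
and for [G = F_sigma] in the other. *)

(** * Nonnegative conditional expectations *)

Lemma ae_ge0_integral_ge0 d (T : measurableType d) (R : realType)
    (mu : {measure set T -> \bar R}) (A : set T) (f : T -> R) :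
  measurable A -> measurable_fun A f ->
  {ae mu, forall w, 0 <= f w} -> (0 <= \int[mu]_(w in A) (f w)%:E)%E.
Proof.
move=> mA mf f0.
(* Passing to the positive part makes the sign hold pointwise. *)
rewrite (ae_eq_integral (fun w => (Num.max 0 (f w))%:E)) //.
- by apply: integral_ge0 => w _; rewrite lee_fin le_max lexx.
- exact/measurable_EFinP.
- by apply/measurable_EFinP; exact: measurable_maxr.
- by apply: filterS f0 => w /= fw _; rewrite max_r.
Qed.

(** The integrals over the single set [{f < 0}] already detect the sign of
[f]: there [|f| = - f] has a nonpositive integral, so [f] vanishes almost
everywhere on a set on which it is nonzero. *)
Lemma integral_neg_part_ge0_ae d (T : measurableType d) (R : realType)
    (mu : {measure set T -> \bar R}) (f : T -> R) :
  mu.-integrable setT (EFin \o f) ->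
  (0 <= \int[mu]_(w in [set w | (f w < 0)%R]) (f w)%:E)%E ->
  {ae mu, forall w, 0 <= f w}.
Proof.
move=> fint; set A := [set w | f w < 0] => f0.
have mf : measurable_fun setT f.
  by apply/measurable_EFinP; case/integrableP: fint.
have mA : measurable A.
  rewrite (_ : A = setT `&` f @^-1` `]-oo, 0[%classic); first exact: mf.
  by rewrite setTI; apply/seteqP; split => w /=; rewrite in_itv.
have fintA : mu.-integrable A (EFin \o f) by exact: integrableS fint.
have mfA : measurable_fun A (EFin \o f) by case/integrableP: fintA.
have abs0 : (\int[mu]_(w in A) `|(EFin \o f) w| = 0)%E.
  apply/eqP; rewrite eq_le integral_ge0 ?andbT; last by move=> w _.
  have -> : (\int[mu]_(w in A) `|(EFin \o f) w| =
             \int[mu]_(w in A) (- (EFin \o f) w))%E.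
    by apply: eq_integral => w; rewrite inE /A /= => fw; rewrite ltr0_norm.
  rewrite integralN ?oppe_le0 //.
  exact: integrable_add_def.
have /(ae_eq_integral_abs mu mA mfA) := abs0.
apply: filterS => w /= fA; rewrite leNgt; apply/negP => fw.
by have [fw0] := fA fw; move: fw; rewrite fw0 ltxx.
Qed.

(** [Y] and [E(Y | G)] have the same integral over every element of [G], and
the set where [E(Y | G)] is negative is itself an element of [G]; testing on
that set is enough for the converse. *)
Lemma cond_exp_ge0P d (T : measurableType d) (R : realType)
    (P : probability T R) (G : set (set T)) (Y : T -> R) :
  sub_sigma_algebra_of G -> P.-integrable setT (EFin \o Y) ->
  {ae P, forall w, 0 <= cond_exp P G Y w} <->
  (forall A, G A -> (0 <= \int[P]_(w in A) (Y w)%:E)%E).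
Proof.
move=> hG iY; have [mZ iZ ZE] := cond_expP hG iY; split => [Z0 A GA|Y0].
- rewrite -ZE //; apply: ae_ge0_integral_ge0 => //; first by case: hG => _; apply.
  apply: measurable_funTS; apply/measurable_EFinP.
  by case/integrableP: iZ.
- apply: integral_neg_part_ge0_ae => //.
  suff GN : G [set w | cond_exp P G Y w < 0] by rewrite ZE //; exact: Y0.
  rewrite -[X in X _](measurable_g_measurableTypeE (proj1 hG)).
  rewrite (_ : [set w | _] = setT `&`
    cond_exp P G Y @^-1` `]-oo, 0[%classic); first exact: mZ.
  by rewrite setTI; apply/seteqP; split => w /=; rewrite in_itv.
Qed.

(** * Increments between two random times *)

(** The event [sigma <= k < tau], written so that its two conditions are the
events that define stopping times. *)
Definition step_between {T : Type} (sigma tau : T -> nat) (k : nat) : set T :=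
  [set w | (sigma w <= k)%N] `&` ~` [set w | (tau w <= k)%N].

Lemma telescope_between (V : zmodType) (x : nat -> V) (s t N : nat) :
  (s <= t)%N -> (t <= N)%N ->
  \sum_(0 <= k < N | (s <= k < t)%N) (x k.+1 - x k) = x t - x s.
Proof.
move=> st tN; rewrite -telescope_sumr // (big_nat_widen _ _ _ _ _ tN).
rewrite (big_nat_widenl s 0) //.
by apply: eq_bigl => k; rewrite andbC.
Qed.

Lemma stopped_increment_sum {T : Type} (R : realType) (X : nat -> T -> R)
    (sigma tau : T -> nat) (N : nat) :
  (forall w, (sigma w <= tau w)%N) -> (forall w, (tau w <= N)%N) ->
  EFin \o (stopped_value X tau \- stopped_value X sigma) =
  (fun w => \sum_(0 <= k < N)
     ((EFin \o (X k.+1 \- X k)%R) \_ (step_between sigma tau k)) w)%E.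
Proof.
move=> st tN; apply/funext => w; rewrite /= /stopped_value.
rewrite -(telescope_between _ (X ^~ w) _ _ N (st w) (tN w)).
rewrite big_mkcond -sumEFin; apply: eq_bigr => k _.
rewrite patchE /step_between; case: ifPn => [/andP[sk kt]|/negP skt].
  by rewrite mem_set //; split => //=; apply/negP; rewrite -ltnNge.
rewrite memNset // => -[/= sk /negP]; rewrite -ltnNge => kt.
by apply: skt; rewrite sk.
Qed.

Section stopped_increment.
Context d (T : measurableType d) (R : realType) (P : probability T R).
Variables (X : nat -> T -> R) (sigma tau : T -> nat) (N : nat).
Hypothesis iX : forall n, P.-integrable setT (EFin \o X n).
Hypothesis msigma : forall n, measurable [set w | (sigma w <= n)%N].
Hypothesis mtau : forall n, measurable [set w | (tau w <= n)%N].
Hypothesis st : forall w, (sigma w <= tau w)%N.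
Hypothesis tN : forall w, (tau w <= N)%N.

Lemma measurable_step_between k : measurable (step_between sigma tau k).
Proof. by apply: measurableI => //; exact: measurableC. Qed.

Lemma integrable_step k :
  P.-integrable setT ((EFin \o (X k.+1 \- X k)%R) \_ (step_between sigma tau k)).
Proof.
have mB := measurable_step_between k.
apply: (iffLR (integrable_mkcond _ mB)); apply: (integrableS measurableT) => //.
exact: (integrableB measurableT (iX k.+1) (iX k)).
Qed.

Lemma integrable_stopped_increment :
  P.-integrable setT (EFin \o (stopped_value X tau \- stopped_value X sigma)).
Proof.
rewrite (stopped_increment_sum _ _ _ _ _ st tN).
by apply: integrable_sum => // k _; exact: integrable_step.
Qed.

Lemma integral_stopped_increment (A : set T) : measurable A ->
  (\int[P]_(w in A) (stopped_value X tau w - stopped_value X sigma w)%:E =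
   \sum_(0 <= k < N)
     \int[P]_(w in A `&` step_between sigma tau k) (X k.+1 w - X k w)%R%:E)%E.
Proof.
move=> mA; have /= E := stopped_increment_sum _ X _ _ _ st tN.
transitivity (\int[P]_(w in A) \sum_(0 <= k < N)
    ((EFin \o (X k.+1 \- X k)%R) \_ (step_between sigma tau k)) w)%E.
  by apply: eq_integral => w _; exact: (congr1 (@^~ w) E).
rewrite integral_sum //; last first.
  by move=> k; apply: integrableS (integrable_step k).
by apply: eq_bigr => k _; rewrite [RHS]integral_mkcondr.
Qed.

End stopped_increment.

(** Comparison with the constant time [0], whose increment telescopes from
[X 0]. *)
Lemma integrable_stopped_value d (T : measurableType d) (R : realType)
    (P : probability T R) (X : nat -> T -> R) (tau : T -> nat) :
  (forall n, P.-integrable setT (EFin \o X n)) ->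
  (forall n, measurable [set w | (tau w <= n)%N]) -> bounded_time tau ->
  P.-integrable setT (EFin \o stopped_value X tau).
Proof.
move=> iX mtau [N tN].
have -> : EFin \o stopped_value X tau = ((EFin \o X 0%N) \+
    (EFin \o (stopped_value X tau \- stopped_value X (fun=> 0%N))%R))%E.
  by apply/funext => w /=; rewrite -EFinD addrC subrK.
apply: integrableD => //; apply: (integrable_stopped_increment _ _ _ _ _ _ _ N) => //.
move=> n; rewrite (_ : [set _ | _] = setT) //.
by apply/seteqP; split.
Qed.

(** * Optional sampling *)

(** This is what allows the one-step inequality between [k] and [k + 1] to be
applied on an event prior to [sigma]: whether the step from [k] to [k + 1]
counts is decided at time [k]. *)
Lemma stopped_sigma_algebra_step {d} {T : measurableType d}
    (F : nat -> set (set T)) (sigma tau : T -> nat) (A : set T) (k : nat) :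
  filtration F -> stopping_time F tau -> stopped_sigma_algebra F sigma A ->
  F k (A `&` step_between sigma tau k).
Proof.
move=> hF htau [_ FA]; have [sF _] := filtration_sub hF k.
rewrite /step_between setIA -[F k](measurable_g_measurableTypeE sF).
by apply: measurableD; rewrite measurable_g_measurableTypeE //.
Qed.

Lemma integral_stopped_increment_ge0 d (T : measurableType d) (R : realType)
    (P : probability T R) (F : nat -> set (set T)) (X : nat -> T -> R)
    (sigma tau : T -> nat) (A : set T) :
  filtration F -> near_submartingale P F X ->
  stopping_time F sigma -> stopping_time F tau -> bounded_time tau ->
  (forall w, (sigma w <= tau w)%N) -> stopped_sigma_algebra F sigma A ->
  (0 <= \int[P]_(w in A)
    (stopped_value X tau w - stopped_value X sigma w)%:E)%E.
Proof.
move=> hF [iX X0] hsigma htau [N tN] st FA.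
have FM n B : F n B -> measurable B by case: (filtration_sub hF n) => _; apply.
rewrite (integral_stopped_increment _ _ _ _ _ _ _ _ iX _ _ st tN); last 3 first.
- by move=> n; exact: FM (hsigma n).
- by move=> n; exact: FM (htau n).
- by case: FA.
apply: sume_ge0 => k _.
apply: (iffLR (cond_exp_ge0P _ _ _ _ _ _ (filtration_sub hF k) _)).
- exact: (integrableB measurableT (iX k.+1) (iX k)).
- exact: X0.
- exact: stopped_sigma_algebra_step.
Qed.

Theorem theorem3p7 (d : measure_display) (Omega : measurableType d)
    (R : realType) (P : probability Omega R)
    (F : nat -> set (set Omega)) (X : nat -> Omega -> R)
    (sigma tau : Omega -> nat)
    (hF : filtration F) (hX : near_submartingale P F X)
    (hsigma : stopping_time F sigma) (htau : stopping_time F tau)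
    (bsigma : bounded_time sigma) (btau : bounded_time tau)
    (hle : forall w, (sigma w <= tau w)%N) :
  [/\ P.-integrable setT (EFin \o stopped_value X sigma),
      P.-integrable setT (EFin \o stopped_value X tau) &
      {ae P, forall w, 0 <= cond_exp P (stopped_sigma_algebra F sigma)
                              (stopped_value X tau \- stopped_value X sigma) w}].
Proof.
have FM n B : F n B -> measurable B by case: (filtration_sub hF n) => _; apply.
have iX := near_submartingale_integrable hX.
have isigma : P.-integrable setT (EFin \o stopped_value X sigma).
  by apply: integrable_stopped_value => // n; exact: FM (hsigma n).
have itau : P.-integrable setT (EFin \o stopped_value X tau).
  by apply: integrable_stopped_value => // n; exact: FM (htau n).
split => //.
apply/cond_exp_ge0P; first exact: stopped_sigma_algebra_sub.
  exact: (integrableB measurableT itau isigma).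
by move=> A FA; exact: integral_stopped_increment_ge0 FA.
Qed.
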